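(* The Banach lattice $E=c_0(\ell_2^n)=\left(\bigoplus_{n=1}^\infty \ell_2^n\right)_0$ has the strong Gelfand-Phillips property; that is, every almost limited subset of $E$ is relatively compact in norm.
   Context: For each $n\ge 1$, $\ell_2^n$ is $\mathbb{R}^n$ with the Euclidean norm and coordinatewise order. $E=\left(\bigoplus_{n=1}^\infty \ell_2^n\right)_0$ is the space of sequences $x=(x_n)_n$ with $x_n\in\ell_2^n$ and $\|x_n\|_2\to 0$, with norm $\sup_n\|x_n\|_2$ and coordinatewise order (the order induced by its canonical unconditional basis). Its dual is $E'=\left(\bigoplus_n \ell_2^n\right)_1$ (norm $\sum_n\|x_n\|_2$), with the coordinatewise order and the natural pairing. In a Banach lattice $F$, a sequence $(x_n)$ is disjoint if $|x_n|\wedge|x_m|=0$ for all $n\ne m$. A bounded subset $A\subset F$ is almost limited if every disjoint weak* null sequence $(f_n)$ in $F'$ converges uniformly to zero on $A$, i.e. $\sup_{x\in A}|f_n(x)|\to 0$. $F$ has the strong Gelfand-Phillips property if every almost limited subset of $F$ is relatively compact. *)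

(* Defs.v *)
From HB Require Import structures.
From mathcomp Require Import all_boot all_order all_algebra.
From mathcomp Require Import all_classical all_reals all_analysis.
From mathcomp Require Import ring.
Set Implicit Arguments.
Unset Strict Implicit.
Unset Printing Implicit Defensive.
Import Order.TTheory GRing.Theory Num.Theory.
Import numFieldNormedType.Exports.
Local Open Scope classical_set_scope.
Local Open Scope ring_scope.

(* The order is a field of the mixin rather than an instance of
   [Order.Lattice]: the latter cannot be joined with [NormedModule], since
   [Num.RealDomain] already inherits from both. *)
HB.mixin Record isBanachLattice (R : realType) V
    & CompleteNormedModule R V := {
  lat_le : V -> V -> Prop ;
  lat_join : V -> V -> V ;
  lat_meet : V -> V -> V ;
  lat_le_refl : forall x, lat_le x x ;
  lat_le_anti : forall x y, lat_le x y -> lat_le y x -> x = y ;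
  lat_le_trans : forall x y z, lat_le x y -> lat_le y z -> lat_le x z ;
  lat_joinP : forall x y z,
    lat_le (lat_join x y) z <-> lat_le x z /\ lat_le y z ;
  lat_meetP : forall x y z,
    lat_le z (lat_meet x y) <-> lat_le z x /\ lat_le z y ;
  lat_leD : forall x y z, lat_le x y -> lat_le (x + z) (y + z) ;
  lat_leZ : forall (a : R) x, 0 <= a -> lat_le 0 x -> lat_le 0 (a *: x) ;
  lat_le_norm : forall x y,
    lat_le (lat_join x (- x)) (lat_join y (- y)) -> `|x| <= `|y| }.

#[short(type="banachLatticeType")]
HB.structure Definition BanachLattice (R : realType) :=
  { V of isBanachLattice R V & CompleteNormedModule R V }.

Record dual (R : realType) (F : banachLatticeType R) := Dual {
  dual_fun :> F -> R^o ;
  dual_linear : linear dual_fun ;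
  dual_continuous : continuous dual_fun }.

Section DualSpace.
Context (R : realType) (F : banachLatticeType R).
Implicit Types (f g h : dual F) (x y z : F).

HB.instance Definition _ f :=
  GRing.isLinear.Build R F R^o *:%R (dual_fun f) (@dual_linear _ _ f).

Lemma dual_ext f g : (forall x, f x = g x) -> f = g.
Proof.
case: f g => [f lf cf] [g lg cg] /= /funext fg; move: lf cf lg cg.
rewrite fg => lf cf lg cg; by congr Dual; exact: Prop_irrelevance.
Qed.

HB.instance Definition _ := gen_eqMixin (dual F).
HB.instance Definition _ := gen_choiceMixin (dual F).

Definition dual_zero : dual F.
Proof.
exists (fun=> 0); first by move=> a x y; rewrite scaler0 addr0.
by move=> x; exact: cvg_cst.
Defined.

Definition dual_opp f : dual F.
Proof.
exists (fun x => - f x).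
  by move=> a x y; rewrite linearP opprD scalerN.
by move=> x; apply: cvgN; exact: dual_continuous.
Defined.

Definition dual_add f g : dual F.
Proof.
exists (fun x => f x + g x).
  by move=> a x y; rewrite !linearP scalerDr addrACA.
by move=> x; apply: cvgD; exact: dual_continuous.
Defined.

Lemma dual_addA : associative dual_add.
Proof. by move=> f g h; apply: dual_ext => x /=; rewrite addrA. Qed.
Lemma dual_addC : commutative dual_add.
Proof. by move=> f g; apply: dual_ext => x /=; rewrite addrC. Qed.
Lemma dual_add0 : left_id dual_zero dual_add.
Proof. by move=> f; apply: dual_ext => x /=; rewrite add0r. Qed.
Lemma dual_addN : left_inverse dual_zero dual_opp dual_add.
Proof. by move=> f; apply: dual_ext => x /=; rewrite addNr. Qed.

HB.instance Definition _ :=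
  GRing.isZmodule.Build (dual F) dual_addA dual_addC dual_add0 dual_addN.

Definition dual_le f g : bool :=
  `[< forall x : F, lat_le 0 x -> (f x : R) <= g x >].

Lemma dual_le_refl : reflexive dual_le.
Proof. by move=> f; apply/asboolP. Qed.

Lemma dual_le_anti : antisymmetric dual_le.
Proof.
move=> f g /andP[/asboolP fg /asboolP gf]; apply: dual_ext => x.
have pos y : lat_le 0 y -> f y = g y.
  by move=> y0; apply/eqP; rewrite eq_le fg// gf.
have /lat_joinP[xU U0] := lat_le_refl (lat_join x 0).
have Ux : lat_le 0 (lat_join x 0 - x) by have := lat_leD _ _ (- x) xU; rewrite subrr.
have -> : x = lat_join x 0 - (lat_join x 0 - x) by rewrite opprB addrC subrK.
rewrite (raddfB f) (raddfB g) /=; congr (_ - _); exact: pos.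
Qed.

Lemma dual_le_trans : transitive dual_le.
Proof.
move=> g f h /asboolP fg /asboolP gh; apply/asboolP => x x0.
exact: le_trans (fg x x0) (gh x x0).
Qed.

HB.instance Definition _ := Order.Le_isPOrder.Build ring_display (dual F)
  dual_le_refl dual_le_anti dual_le_trans.

End DualSpace.

Section StrongGelfandPhillips.
Context (R : realType) (F : banachLatticeType R).

(* |f| /\ |g| = 0 in F', the suprema and the infimum being taken in the poset
   F' (which is a lattice, by the Riesz-Kantorovich theorem). *)
Definition dual_disjoint (f g : dual F) : Prop :=
  exists mf mg : dual F,
    [/\ supremums [set f; - f] mf, supremums [set g; - g] mg
      & infimums [set mf; mg] 0].

Definition disjoint_seq (f : nat -> dual F) : Prop :=
  forall n m, n <> m -> dual_disjoint (f n) (f m).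

Definition weak_star_null (f : nat -> dual F) : Prop :=
  forall x : F, (f n x : R) @[n --> \oo] --> (0 : R).

Definition almost_limited (A : set F) : Prop :=
  bounded_set A /\
  forall f : nat -> dual F, disjoint_seq f -> weak_star_null f ->
    sup [set `|f n x : R| | x in A] @[n --> \oo] --> (0 : R).

Definition strong_Gelfand_Phillips : Prop :=
  forall A : set F, almost_limited A -> compact (closure A).

End StrongGelfandPhillips.

Arguments strong_Gelfand_Phillips {R} F.

Section Euclidean.
Context (R : realType).

Definition l2norm n (v : 'rV[R]_n) : R := Num.sqrt (\sum_(i < n) v 0 i ^+ 2).

Lemma l2norm_ge0 n (v : 'rV[R]_n) : 0 <= l2norm v.
Proof. exact: sqrtr_ge0. Qed.

Lemma l2norm_sqr n (v : 'rV[R]_n) : l2norm v ^+ 2 = \sum_(i < n) v 0 i ^+ 2.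
Proof. by rewrite sqr_sqrtr// sumr_ge0// => i _; exact: sqr_ge0. Qed.

Lemma l2norm0 n : l2norm (0 : 'rV[R]_n) = 0.
Proof.
by rewrite /l2norm big1 ?sqrtr0// => i _; rewrite mxE expr0n.
Qed.

Lemma l2normZ n (a : R) (v : 'rV[R]_n) : l2norm (a *: v) = `|a| * l2norm v.
Proof.
rewrite /l2norm -[`|a|]sqrtr_sqr -sqrtrM ?sqr_ge0// mulr_sumr.
by congr Num.sqrt; apply: eq_bigr => i _; rewrite mxE exprMn.
Qed.

Lemma l2normN n (v : 'rV[R]_n) : l2norm (- v) = l2norm v.
Proof. by rewrite -scaleN1r l2normZ normrN1 mul1r. Qed.

Lemma coord_le_l2norm n (v : 'rV[R]_n) i : `|v 0 i| <= l2norm v.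
Proof.
rewrite -sqrtr_sqr ler_wsqrtr// (bigD1 i)//= lerDl.
by rewrite sumr_ge0// => j _; exact: sqr_ge0.
Qed.

Lemma l2norm_eq0 n (v : 'rV[R]_n) : l2norm v = 0 -> v = 0.
Proof.
move=> v0; apply/rowP => i; rewrite mxE; apply/eqP.
by rewrite -normr_le0 -v0 coord_le_l2norm.
Qed.

Lemma ler_l2norm n (v w : 'rV[R]_n) :
  (forall i, `|v 0 i| <= `|w 0 i|) -> l2norm v <= l2norm w.
Proof.
move=> vw; rewrite ler_wsqrtr// ler_sum// => i _.
by rewrite -(real_normK (num_real (v 0 i))) -(real_normK (num_real (w 0 i)))
  lerXn2r// nnegrE.
Qed.

Lemma l2norm_cauchy n (v w : 'rV[R]_n) :
  \sum_(i < n) v 0 i * w 0 i <= l2norm v * l2norm w.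
Proof.
have [v0|vN0] := eqVneq (l2norm v) 0.
  rewrite v0 mul0r (l2norm_eq0 v0) big1// => i _.
  by rewrite mxE mul0r.
have [w0|wN0] := eqVneq (l2norm w) 0.
  rewrite w0 mulr0 (l2norm_eq0 w0) big1// => i _.
  by rewrite mxE mulr0.
have v0 : 0 < l2norm v by rewrite lt_neqAle eq_sym vN0 l2norm_ge0.
have w0 : 0 < l2norm w by rewrite lt_neqAle eq_sym wN0 l2norm_ge0.
set a := l2norm v in vN0 v0 *; set b := l2norm w in wN0 w0 *.
have : 0 <= \sum_(i < n) (b * v 0 i - a * w 0 i) ^+ 2.
  by rewrite sumr_ge0// => i _; exact: sqr_ge0.
have sqE i : (b * v 0 i - a * w 0 i) ^+ 2 = b ^+ 2 * v 0 i ^+ 2 +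
    a ^+ 2 * w 0 i ^+ 2 + (- (2 * a * b)) * (v 0 i * w 0 i) by ring.
rewrite (eq_bigr _ (fun i _ => sqE i)).
rewrite !big_split/= -!mulr_sumr -!l2norm_sqr -/a -/b.
set S := \sum_(i < n) _.
rewrite (_ : _ + _ = (2 * a * b) * (a * b - S)); last by ring.
by rewrite pmulr_rge0 ?mulr_gt0// subr_ge0.
Qed.

Lemma ler_l2normD n (v w : 'rV[R]_n) : l2norm (v + w) <= l2norm v + l2norm w.
Proof.
rewrite -(@ler_pXn2r _ 2)// ?nnegrE ?addr_ge0 ?l2norm_ge0//.
rewrite sqrrD !l2norm_sqr.
under eq_bigr => i _ do rewrite mxE sqrrD.
rewrite !big_split/= lerD2r lerD2l mulr2n.
by rewrite lerD// l2norm_cauchy.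
Qed.

End Euclidean.

(* The block of index [n : nat] is l_2^(n+1), so that the blocks are exactly
   the l_2^k for k >= 1. *)
Record c0l2 (R : realType) := C0l2 {
  blk : forall n : nat, 'rV[R]_n.+1 ;
  blk_cvg0 : l2norm (blk n) @[n --> \oo] --> (0 : R) }.

Section C0l2.
Context (R : realType).
Implicit Types (x y z : c0l2 R).

Lemma c0l2_ext x y : (forall n i, blk x n 0 i = blk y n 0 i) -> x = y.
Proof.
case: x y => [x cx] [y cy] /= xy.
have exy : x = y by apply: functional_extensionality_dep => n; exact/rowP.
move: cx cy; rewrite exy => cx cy; congr C0l2; exact: Prop_irrelevance.
Qed.

HB.instance Definition _ := gen_eqMixin (c0l2 R).
HB.instance Definition _ := gen_choiceMixin (c0l2 R).

Lemma c0l2_squeeze (v : forall n, 'rV[R]_n.+1) (u : nat -> R) :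
  (forall n, l2norm (v n) <= u n) -> u n @[n --> \oo] --> (0 : R) ->
  l2norm (v n) @[n --> \oo] --> (0 : R).
Proof.
move=> vu u0; apply: (squeeze_cvgr _ (cvg_cst 0) u0).
by apply: nearW => n; rewrite l2norm_ge0 vu.
Qed.

Definition c0l2_zero : c0l2 R.
Proof.
exists (fun n => 0); apply: (@c0l2_squeeze _ (fun=> 0)); last exact: cvg_cst.
by move=> n; rewrite l2norm0.
Defined.

Definition c0l2_opp x : c0l2 R.
Proof.
exists (fun n => - blk x n); apply: c0l2_squeeze (blk_cvg0 x) => n.
by rewrite l2normN.
Defined.

Definition c0l2_add x y : c0l2 R.
Proof.
exists (fun n => blk x n + blk y n).
apply: (@c0l2_squeeze _ (fun n => l2norm (blk x n) + l2norm (blk y n))).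
  by move=> n; exact: ler_l2normD.
by rewrite -[0]addr0; apply: cvgD; exact: blk_cvg0.
Defined.

Definition c0l2_scale (a : R) x : c0l2 R.
Proof.
exists (fun n => a *: blk x n).
apply: (@c0l2_squeeze _ (fun n => `|a| * l2norm (blk x n))).
  by move=> n; rewrite l2normZ.
by rewrite -(mulr0 `|a|); apply: cvgMr; exact: blk_cvg0.
Defined.

Lemma c0l2_addA : associative c0l2_add.
Proof. by move=> x y z; apply: c0l2_ext => n i /=; rewrite addrA. Qed.
Lemma c0l2_addC : commutative c0l2_add.
Proof. by move=> x y; apply: c0l2_ext => n i /=; rewrite addrC. Qed.
Lemma c0l2_add0 : left_id c0l2_zero c0l2_add.
Proof. by move=> x; apply: c0l2_ext => n i /=; rewrite add0r. Qed.
Lemma c0l2_addN : left_inverse c0l2_zero c0l2_opp c0l2_add.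
Proof. by move=> x; apply: c0l2_ext => n i /=; rewrite addNr. Qed.

HB.instance Definition _ :=
  GRing.isZmodule.Build (c0l2 R) c0l2_addA c0l2_addC c0l2_add0 c0l2_addN.

Lemma c0l2_scaleA a b x :
  c0l2_scale a (c0l2_scale b x) = c0l2_scale (a * b) x.
Proof. by apply: c0l2_ext => n i /=; rewrite scalerA. Qed.
Lemma c0l2_scale1 : left_id 1 c0l2_scale.
Proof. by move=> x; apply: c0l2_ext => n i /=; rewrite scale1r. Qed.
Lemma c0l2_scaleDr : right_distributive c0l2_scale +%R.
Proof. by move=> a x y; apply: c0l2_ext => n i /=; rewrite scalerDr. Qed.
Lemma c0l2_scaleDl x : {morph c0l2_scale^~ x : a b / a + b}.
Proof. by move=> a b; apply: c0l2_ext => n i /=; rewrite scalerDl. Qed.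

HB.instance Definition _ := GRing.Zmodule_isLmodule.Build R (c0l2 R)
  c0l2_scaleA c0l2_scale1 c0l2_scaleDr c0l2_scaleDl.

Definition c0l2_norm x : R := sup [set l2norm (blk x n) | n in [set: nat]].

Lemma blk_has_sup x : has_sup [set l2norm (blk x n) | n in [set: nat]].
Proof.
split; first by exists (l2norm (blk x 0)), 0%N.
have [M [_ /(_ (M + 1))]] : bounded_fun (fun n => l2norm (blk x n)).
  by apply: cvg_seq_bounded; apply/cvg_ex; exists 0; exact: blk_cvg0.
rewrite ltrDl => /(_ ltr01) Mx; exists (M + 1) => _ [n _ <-].
by apply: le_trans (Mx n I); rewrite ler_norm.
Qed.

Lemma blk_le_norm x n : l2norm (blk x n) <= c0l2_norm x.
Proof. by apply: sup_upper_bound; [exact: blk_has_sup|exists n]. Qed.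

Lemma c0l2_norm_le x (M : R) :
  (forall n, l2norm (blk x n) <= M) -> c0l2_norm x <= M.
Proof.
move=> xM; apply: ge_sup; first by have [] := blk_has_sup x.
by move=> _ [n _ <-].
Qed.

Lemma c0l2_norm_ge0 x : 0 <= c0l2_norm x.
Proof. exact: le_trans (l2norm_ge0 _) (blk_le_norm x 0). Qed.

Lemma c0l2_normD x y : c0l2_norm (x + y) <= c0l2_norm x + c0l2_norm y.
Proof.
apply: c0l2_norm_le => n; apply: le_trans (ler_l2normD _ _) _.
by rewrite lerD// blk_le_norm.
Qed.

Lemma c0l2_normZ_le a x : c0l2_norm (a *: x) <= `|a| * c0l2_norm x.
Proof.
apply: c0l2_norm_le => n; rewrite l2normZ.
by rewrite ler_wpM2l// blk_le_norm.
Qed.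

Lemma c0l2_norm_eq0 x : c0l2_norm x = 0 -> x = 0.
Proof.
move=> x0; apply: c0l2_ext => n i; apply/eqP; rewrite mxE -normr_le0 -x0.
exact: le_trans (coord_le_l2norm _ _) (blk_le_norm _ _).
Qed.

Lemma c0l2_normZ a x : c0l2_norm (a *: x) = `|a| * c0l2_norm x.
Proof.
apply/eqP; rewrite eq_le c0l2_normZ_le/=.
have [->|a0] := eqVneq a 0; first by rewrite normr0 mul0r c0l2_norm_ge0.
rewrite -{1}(scale1r x) -(mulVf a0) -scalerA.
rewrite (le_trans (ler_wpM2l (normr_ge0 _) (c0l2_normZ_le _ _)))//.
by rewrite mulrA -normrM divff// normr1 mul1r.
Qed.

HB.instance Definition _ := Lmodule_isNormed.Build R (c0l2 R)
  c0l2_normD c0l2_normZ c0l2_norm_eq0.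

Lemma normc0l2E x : `|x| = c0l2_norm x. Proof. by []. Qed.

Lemma coord_le_normB x y n i : `|blk x n 0 i - blk y n 0 i| <= `|x - y|.
Proof.
apply: le_trans (blk_le_norm (x - y) n); apply: le_trans (coord_le_l2norm _ i).
by rewrite !mxE.
Qed.

Lemma cvg_l2normB n (v : 'rV[R]_n) (T : Type) (G : set_system T)
    (u : T -> 'rV[R]_n) (l : 'rV[R]_n) : Filter G ->
  (forall i, u y 0 i @[y --> G] --> l 0 i) ->
  l2norm (v - u y) @[y --> G] --> l2norm (v - l).
Proof.
move=> GG ul; apply: (@cvg_comp _ _ _ _ Num.sqrt _ _ _ _ (@sqrt_continuous R _)).
apply: cvg_big => [|i _]; first exact: add_continuous.
under eq_fun do rewrite expr2 2!mxE; rewrite expr2 2!mxE.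
by apply: cvgM; apply: cvgB => //; exact: cvg_cst.
Qed.

Lemma c0l2_complete (G : set_system (c0l2 R)) :
  ProperFilter G -> cauchy G -> cvg G.
Proof.
move=> GG /cauchy_ballP Gc.
have cc n i : cvg (blk x n 0 i @[x --> G]).
  apply: cauchy_cvg; apply/cauchy_ballP => e e0; rewrite near_map2.
  have := Gc _ e0; apply: filterS => -[x y] /=.
  rewrite -!ball_normE /= => xy.
  apply: le_lt_trans xy; exact: coord_le_normB.
pose l n : 'rV[R]_n.+1 := \row_i lim (blk x n 0 i @[x --> G]).
have Gl e : 0 < e -> \forall x \near G, forall n, l2norm (blk x n - l n) <= e.
  move=> e0; have : \forall x \near G, \forall y \near G, ball x e y.
    by apply: nearP_dep; exact: Gc.
  apply: filterS => x Gx n.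
  have xl : l2norm (blk x n - blk y n) @[y --> G] --> l2norm (blk x n - l n).
    by apply: cvg_l2normB => i; rewrite mxE; exact: cc.
  rewrite -(cvg_lim _ xl)//; apply: limr_le; first by apply/cvg_ex; eexists; exact: xl.
  apply: filterS Gx => y; rewrite -ball_normE /= => /ltW.
  exact: le_trans (blk_le_norm (x - y) n).
have l0 : l2norm (l n) @[n --> \oo] --> (0 : R).
  apply/cvgrPdist_le => e e0.
  have e20 : 0 < e / 2 by rewrite divr_gt0.
  have [x xl] := filter_ex (Gl _ e20).
  have /cvgrPdist_le /(_ _ e20) := blk_cvg0 x.
  apply: filterS => n; rewrite !sub0r !normrN !ger0_norm ?l2norm_ge0// => xe.
  rewrite -[l n](subrK (blk x n)) (le_trans (ler_l2normD _ _))//.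
  by rewrite [e]splitr lerD// -l2normN opprB.
apply/cvg_ex; exists (C0l2 l0); apply/cvgrPdist_le => e /Gl.
apply: filterS => x xl; rewrite distrC; apply: c0l2_norm_le => n.
exact: xl.
Qed.

HB.instance Definition _ := Uniform_isComplete.Build (c0l2 R) c0l2_complete.

Definition c0l2_le x y : Prop := forall n i, blk x n 0 i <= blk y n 0 i.

Lemma c0l2_blk_map2 (op : R -> R -> R) x y :
  (forall a b, `|op a b| <= `|a| + `|b|) ->
  l2norm (map2_mx op (blk x n) (blk y n)) @[n --> \oo] --> (0 : R).
Proof.
move=> opP.
apply: (@c0l2_squeeze _ (fun n => l2norm (blk x n) + l2norm (blk y n))).
  move=> n; set v := map_mx Num.norm (blk x n); set w := map_mx Num.norm (blk y n).
  apply: (@le_trans _ _ (l2norm (v + w))).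
    apply: ler_l2norm => i; rewrite !mxE (le_trans (opP _ _))//.
    by rewrite ler_norm.
  rewrite (le_trans (ler_l2normD _ _))// lerD//;
    by apply: ler_l2norm => i; rewrite /v /w mxE normr_id.
by rewrite -[0]addr0; apply: cvgD; exact: blk_cvg0.
Qed.

Lemma norm_max_le (a b : R) : `|Num.max a b| <= `|a| + `|b|.
Proof. by rewrite /Order.max; case: ifP => _; rewrite ?lerDl ?lerDr normr_ge0. Qed.

Lemma norm_min_le (a b : R) : `|Num.min a b| <= `|a| + `|b|.
Proof. by rewrite /Order.min; case: ifP => _; rewrite ?lerDl ?lerDr normr_ge0. Qed.

Definition c0l2_join x y : c0l2 R := C0l2 (c0l2_blk_map2 x y norm_max_le).
Definition c0l2_meet x y : c0l2 R := C0l2 (c0l2_blk_map2 x y norm_min_le).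

Lemma c0l2_le_refl x : c0l2_le x x. Proof. by []. Qed.

Lemma c0l2_le_anti x y : c0l2_le x y -> c0l2_le y x -> x = y.
Proof.
by move=> xy yx; apply: c0l2_ext => n i; apply/eqP; rewrite eq_le xy yx.
Qed.

Lemma c0l2_le_trans x y z : c0l2_le x y -> c0l2_le y z -> c0l2_le x z.
Proof. by move=> xy yz n i; exact: le_trans (xy n i) (yz n i). Qed.

Lemma c0l2_joinP x y z :
  c0l2_le (c0l2_join x y) z <-> c0l2_le x z /\ c0l2_le y z.
Proof.
split=> [xyz|[xz yz] n i]; last by rewrite mxE ge_max xz yz.
by split=> n i; have := xyz n i; rewrite mxE ge_max => /andP[].
Qed.

Lemma c0l2_meetP x y z :
  c0l2_le z (c0l2_meet x y) <-> c0l2_le z x /\ c0l2_le z y.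
Proof.
split=> [zxy|[zx zy] n i]; last by rewrite mxE le_min zx zy.
by split=> n i; have := zxy n i; rewrite mxE le_min => /andP[].
Qed.

Lemma c0l2_leD x y z : c0l2_le x y -> c0l2_le (x + z) (y + z).
Proof. by move=> xy n i; rewrite !mxE lerD2r. Qed.

Lemma c0l2_leZ a x : 0 <= a -> c0l2_le 0 x -> c0l2_le 0 (a *: x).
Proof.
by move=> a0 x0 n i; have := x0 n i; rewrite !mxE => xni; rewrite mulr_ge0.
Qed.

Lemma c0l2_le_norm x y :
  c0l2_le (c0l2_join x (- x)) (c0l2_join y (- y)) -> `|x| <= `|y|.
Proof.
move=> xy; apply: c0l2_norm_le => n; apply: le_trans (blk_le_norm y n).
by apply: ler_l2norm => i; have := xy n i; rewrite !mxE !maxrN.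
Qed.

HB.instance Definition _ := isBanachLattice.Build R (c0l2 R)
  c0l2_le_refl c0l2_le_anti c0l2_le_trans c0l2_joinP c0l2_meetP
  c0l2_leD c0l2_leZ c0l2_le_norm.

End C0l2.

(* Main.v *)
(** Forms supported on distinct blocks are disjoint, and a sequence of forms of
norm at most [1], the n-th one on the n-th block, is weak* null because the
block norms of every element tend to [0]. Choosing the n-th form to norm the
n-th block of a near-maximal element of an almost limited set [A] shows that
the suprema over [A] of the block norms tend to [0]. The elements whose block
norms are dominated by a fixed null sequence form a compact set: each block
lives in a finite-dimensional space and the tails are uniformly small. *)
Require Import Defs.
From mathcomp Require Import all_boot all_order all_algebra.
From mathcomp Require Import all_classical all_reals all_analysis.
Set Implicit Arguments.
Unset Strict Implicit.
Unset Printing Implicit Defensive.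
Import Order.TTheory GRing.Theory Num.Theory.
Import numFieldNormedType.Exports.
Local Open Scope classical_set_scope.
Local Open Scope ring_scope.

(** Maximality transfers: for [B] in a finer proper filter [G], either the preimage of [B] or its
    complement is in [F], and the latter would put [B] and its complement both in [G]. *)
Lemma ultra_fmap (T U : Type) (f : T -> U) (F : set_system T) :
  UltraFilter F -> UltraFilter (f @ F).
Proof.
move=> FU; split=> [|G GG FG]; first exact: fmap_proper_filter.
apply/seteqP; split=> // B GB.
have [//|nFB] := in_ultra_setVsetC (f @^-1` B) FU.
have : G (B `&` ~` B) by apply: filterI => //; exact: FG.
by rewrite setICr => /filter_not_empty.
Qed.

Section BlockForms.
Context (R : realType).
Implicit Types (x y : c0l2 R).

Lemma l2norm_cauchy_norm n (v w : 'rV[R]_n) :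
  `|\sum_(i < n) v 0 i * w 0 i| <= l2norm v * l2norm w.
Proof.
rewrite ler_norml l2norm_cauchy andbT lerNl -sumrN -(l2normN v).
rewrite (eq_bigr (fun i => (- v) 0 i * w 0 i)) ?l2norm_cauchy// => i _.
by rewrite mxE mulNr.
Qed.

Definition blkform_fun n (v : 'rV[R]_n.+1) (x : c0l2 R) : R^o :=
  \sum_(i < n.+1) v 0 i * blk x n 0 i.

Lemma blkform_linear n (v : 'rV[R]_n.+1) : linear (blkform_fun v).
Proof.
move=> a x y; rewrite /blkform_fun scaler_sumr -big_split/=.
by apply: eq_bigr => i _; rewrite !mxE mulrDr mulrCA.
Qed.

Lemma blkform_continuous n (v : 'rV[R]_n.+1) : continuous (blkform_fun v).
Proof.
move=> x; have ? : Filter (nbhs x) := nbhs_filter x; apply: cvg_big => [|i _]; first exact: add_continuous.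
apply: cvgMr; apply/cvgrPdist_le => e e0.
apply: filterS (nbhsx_ballx x e e0) => y; rewrite -ball_normE /= => /ltW.
by move=> xy; apply: le_trans xy; exact: coord_le_normB.
Qed.

Definition blkform n (v : 'rV[R]_n.+1) : dual (c0l2 R) :=
  Dual (@blkform_linear n v) (@blkform_continuous n v).

Lemma blkform_bound n (v : 'rV[R]_n.+1) x :
  `|blkform v x : R| <= l2norm v * l2norm (blk x n).
Proof. exact: l2norm_cauchy_norm. Qed.

Lemma c0l2_mask_subproof (p : forall n, 'I_n.+1 -> bool) x :
  l2norm (\row_(i < n.+1) if p n i then blk x n 0 i else 0) @[n --> \oo]
  --> (0 : R).
Proof.
apply: c0l2_squeeze (blk_cvg0 x) => n; apply: ler_l2norm => i.
by rewrite mxE; case: ifP; rewrite ?normr0.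
Qed.

(** The band projection onto the coordinates selected by [p]. Splitting positive elements with it
    gives the suprema and infima of forms below. *)
Definition c0l2_mask p x : c0l2 R := C0l2 (@c0l2_mask_subproof p x).

Lemma c0l2_mask_ge0 p x : lat_le 0 x -> lat_le 0 (c0l2_mask p x).
Proof.
by move=> x0 n i; rewrite !mxE; case: ifP => // _; have := x0 n i; rewrite mxE.
Qed.

Lemma c0l2_maskC p x :
  c0l2_mask p x + c0l2_mask (fun n i => ~~ p n i) x = x.
Proof.
apply: c0l2_ext => n i; rewrite !mxE.
by case: (p n i); rewrite ?addr0 ?add0r.
Qed.

(** For leastness, an upper bound [h] is evaluated separately on the part of [x] where [v] is
    nonnegative, using [blkform v <= h], and on the rest, using [- blkform v <= h]. *)
Lemma blkform_supremum n (v : 'rV[R]_n.+1) :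
  supremums [set blkform v; - blkform v] (blkform (map_mx Num.norm v)).
Proof.
split=> [_ [|] ->|h hub].
- apply/asboolP => x x0; apply: ler_sum => i _; rewrite mxE ler_wpM2r ?ler_norm//.
  by have := x0 n i; rewrite mxE.
- apply/asboolP => x x0; rewrite /= -sumrN; apply: ler_sum => i _.
  rewrite mxE -mulNr ler_wpM2r//; first by have := x0 n i; rewrite mxE.
  by rewrite -normrN ler_norm.
- apply/asboolP => x x0.
  (* A mask concerns all blocks, so [inord] carries any index to block [n]; on block [n] itself it
     is the identity. *)
  pose p m (j : 'I_m.+1) := 0 <= v 0 (inord j).
  have /asboolP hv : blkform v <= h by apply: hub; left.
  have /asboolP hNv : - blkform v <= h by apply: hub; right.
  rewrite -[in leRHS](c0l2_maskC p x) raddfD/=.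
  apply: le_trans (lerD (hv _ (c0l2_mask_ge0 p x0))
    (hNv _ (c0l2_mask_ge0 (fun n i => ~~ p n i) x0))).
  rewrite /= /blkform_fun -sumrN -big_split/=; apply: ler_sum => i _.
  rewrite !mxE /p inord_val; case: ger0P => _ /=.
    by rewrite mulr0 subr0.
  by rewrite mulr0 add0r mulNr.
Qed.

(** A positive [x] is split into its block [n] and the rest: the form on block [m] vanishes on the
    former and the form on block [n] on the latter, so a common lower bound is at most [0] at
    [x]. *)
Lemma blkform_disjoint m n (v : 'rV[R]_m.+1) (w : 'rV[R]_n.+1) :
  m <> n -> dual_disjoint (blkform v) (blkform w).
Proof.
move=> /eqP mn; exists (blkform (map_mx Num.norm v)), (blkform (map_mx Num.norm w)).
split; [exact: blkform_supremum|exact: blkform_supremum|split].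
  by move=> _ [|] ->; apply/asboolP => x x0; apply: sumr_ge0 => i _;
    rewrite mxE mulr_ge0//; have := x0 _ i; rewrite mxE.
move=> h hlb; apply/asboolP => x x0.
pose p k (j : 'I_k.+1) := k == n.
have /asboolP hv : h <= blkform (map_mx Num.norm v) by apply: hlb; left.
have /asboolP hw : h <= blkform (map_mx Num.norm w) by apply: hlb; right.
rewrite -[in leLHS](c0l2_maskC p x) raddfD/=.
apply: le_trans (lerD (hv _ (c0l2_mask_ge0 p x0))
  (hw _ (c0l2_mask_ge0 (fun n i => ~~ p n i) x0))) _.
rewrite /= /blkform_fun !big1 ?addr0// => i _; rewrite !mxE /p.
  by rewrite eqxx mulr0.
by rewrite (negbTE mn) mulr0.
Qed.

End BlockForms.

Section Compactness.
Context (R : realType).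

(** Along an ultrafilter on [K] each coordinate stays in a segment, hence converges; the
    coordinatewise limit inherits the bound [s] and so lies in [K]. *)
Lemma c0l2_dominated_compact (s : nat -> R) : s n @[n --> \oo] --> (0 : R) ->
  compact [set x : c0l2 R | forall n, l2norm (blk x n) <= s n].
Proof.
set K := [set _ | _] => s0; rewrite compact_ultra => G GU GK.
have coordK n i : \forall x \near G, blk x n 0 i \in `[- s n, s n].
  apply: filterS GK => x xK; rewrite in_itv/= -ler_norml.
  exact: le_trans (coord_le_l2norm _ _) (xK n).
have coord_cvg n i : cvg (blk x n 0 i @[x --> G]).
  have := @segment_compact R (- s n) (s n); rewrite compact_ultra.
  by move=> /(_ _ (ultra_fmap _ GU) (coordK n i)) [l [_ Gl]];
    apply/cvg_ex; exists l.
pose l n : 'rV[R]_n.+1 := \row_i lim (blk x n 0 i @[x --> G]).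
have Gl n (v : 'rV[R]_n.+1) :
    l2norm (v - blk x n) @[x --> G] --> l2norm (v - l n).
  by apply: cvg_l2normB => i; rewrite mxE; exact: coord_cvg.
have ls n : l2norm (l n) <= s n.
  have := Gl n 0; rewrite sub0r l2normN => Gl0.
  rewrite -(cvg_lim _ Gl0)//; apply: limr_le.
    by apply/cvg_ex; eexists; exact: Gl0.
  by apply: filterS GK => x; rewrite sub0r l2normN; exact.
exists (C0l2 (c0l2_squeeze ls s0)); split; first exact: ls.
apply/cvgrPdist_le => e e0.
have e20 : 0 < e / 2 by rewrite divr_gt0.
(* From [N] on, [s] is at most [e / 2], so blocks of differences of elements of [K] have norm at
   most [e]; the finitely many earlier blocks are handled by convergence along [G]. *)
have /cvgrPdist_le /(_ _ e20) [N _ sN] := s0.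
have : \forall x \near G, forall n : 'I_N, l2norm (l n - blk x n) <= e.
  apply: filter_forall => n; have := Gl n (l n).
  rewrite subrr l2norm0 => /cvgrPdist_le/(_ _ e0).
  by apply: filterS => x; rewrite sub0r normrN ger0_norm ?l2norm_ge0.
move=> Gx; apply: filterS2 Gx GK => x xl xK.
apply: c0l2_norm_le => n /=.
have [nN|Nn] := ltnP n N; first exact: (xl (Ordinal nN)).
rewrite (le_trans (ler_l2normD _ _))// l2normN [e]splitr.
have := sN _ Nn; rewrite sub0r normrN => /(le_trans (ler_norm _)) sne.
by rewrite lerD// (le_trans _ sne).
Qed.

End Compactness.

Section AlmostLimited.
Context (R : realType).

Lemma almost_limited_blk_cvg0 (A : set (c0l2 R)) : A !=set0 ->
  almost_limited A ->
  sup [set l2norm (blk x n) | x in A] @[n --> \oo] --> (0 : R).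
Proof.
(* [bounded_set] bounds the norms by every number strictly above [M], whence [M + 1]. *)
move=> [a Aa] [[M [_ /(_ (M + 1))]]]; rewrite ltrDl ltr01 => /(_ isT) AM Alim.
set s := fun n => _.
have hs n : has_sup [set l2norm (blk x n) | x in A].
  split; first by exists (l2norm (blk a n)), a.
  by exists (M + 1) => _ [x Ax <-]; exact: le_trans (blk_le_norm _ _) (AM x Ax).
(* The supremum may not be attained; the margin [n.+1%:R^-1] tends to [0] and is absorbed in the
   final squeeze. *)
have near_sup n : exists x, A x /\ s n - n.+1%:R^-1 < l2norm (blk x n).
  have n0 : 0 < n.+1%:R^-1 :> R by rewrite invr_gt0.
  by have [_ [x Ax <-] sx] := sup_adherent n0 (hs n); exists x.
have [y Ay] := choice near_sup.
(* When [blk (y n) n = 0] this is [0], as [0^-1 = 0]. *)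
pose u n := (l2norm (blk (y n) n))^-1 *: blk (y n) n.
have u1 n : l2norm (u n) <= 1.
  rewrite l2normZ ger0_norm ?invr_ge0 ?l2norm_ge0//.
  have [->|y0] := eqVneq (l2norm (blk (y n) n)) 0; first by rewrite mulr0.
  by rewrite mulVf.
have uy n : blkform (u n) (y n) = l2norm (blk (y n) n).
  rewrite /= /blkform_fun.
  under eq_bigr do rewrite mxE -mulrA -expr2.
  rewrite -mulr_sumr -l2norm_sqr expr2.
  have [->|y0] := eqVneq (l2norm (blk (y n) n)) 0; first by rewrite !mulr0.
  by rewrite mulKf.
(* This bound serves twice: it makes the forms weak* null, and it makes their suprema over the
   bounded set [A] finite. *)
have ub n x : `|blkform (u n) x : R| <= l2norm (blk x n).
  by rewrite (le_trans (blkform_bound _ _))// ler_piMl ?l2norm_ge0.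
have := Alim (fun n => blkform (u n)).
move=> /(_ (fun m n mn => blkform_disjoint _ _ mn)) u0.
have {}u0 : sup [set `|blkform (u n) x : R| | x in A] @[n --> \oo] --> (0 : R).
  apply: u0 => x; apply/cvgr0Pnorm_le => e e0.
  have /cvgr0Pnorm_le /(_ _ e0) := blk_cvg0 x.
  by apply: filterS => n; rewrite ger0_norm ?l2norm_ge0//; exact: le_trans.
apply: (@squeeze_cvgr _ _ _ _ (fun=> 0) (fun n =>
  sup [set `|blkform (u n) x : R| | x in A] + n.+1%:R^-1)); last 2 first.
- exact: cvg_cst.
- by rewrite -[0]addr0; apply: cvgD => //; exact: cvg_harmonic.
apply: nearW => n; apply/andP; split.
  by apply: le_trans (l2norm_ge0 (blk a n)) _; apply: sup_upper_bound => //;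
    exists a.
have [Ayn /ltW] := Ay n; rewrite lerBlDr => /le_trans; apply; rewrite lerD2r.
apply: (@le_trans _ _ `|blkform (u n) (y n) : R|); first by rewrite uy ler_norm.
apply: sup_upper_bound; last by exists (y n).
split; first by exists `|blkform (u n) (y n) : R|, (y n).
exists (M + 1) => _ [x Ax <-]; apply: le_trans (ub n x) _.
exact: le_trans (blk_le_norm _ _) (AM x Ax).
Qed.

End AlmostLimited.

Theorem theorem2p6 (R : realType) : strong_Gelfand_Phillips (c0l2 R).
Proof.
move=> A Alim; have [->|/set0P A0] := eqVneq A set0.
  by rewrite closure0; exact: compact0.
(* The dominating sequence consists of the suprema over [A] of the block norms, so that [A] is
   contained in [K]. *)
have /c0l2_dominated_compact := almost_limited_blk_cvg0 A0 Alim.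
set K := [set _ | _] => Kc.
rewrite -precompactE; apply: (@precompact_subset _ _ K); last first.
  by rewrite precompact_closed//; apply: compact_closed Kc; exact: norm_hausdorff.
move=> x Ax n; apply: sup_upper_bound; last by exists x.
(* Boundedness of [A] ensures that these suprema are true upper bounds. *)
have [[M [_ /(_ (M + 1))]]] := Alim; rewrite ltrDl ltr01 => /(_ isT) AM _.
split; first by exists (l2norm (blk x n)), x.
by exists (M + 1) => _ [z Az <-]; exact: le_trans (blk_le_norm _ _) (AM z Az).
Qed.
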